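(* For every non-constant polynomial $P$ with complex coefficients, the entire function $f(z)=e^z+P(z)$ has Baker omitted value (that is, $\infty$ is a Baker omitted value of $f$).
   Context: Write $\widehat{\mathbb{C}}=\mathbb{C}\cup\{\infty\}$. A point $a\in\widehat{\mathbb{C}}$ is an omitted value of an entire function $f:\mathbb{C}\to\widehat{\mathbb{C}}$ if $f(z)\neq a$ for all $z\in\mathbb{C}$ (so $\infty$ is an omitted value of every entire function). An omitted value $a\in\widehat{\mathbb{C}}$ of an entire function $f$ is called a Baker omitted value (bov) if there is a disk $D$ in $\widehat{\mathbb{C}}$ with center at $a$ such that each connected component of the boundary of $f^{-1}(D)=\{z\in\mathbb{C}: f(z)\in D\}$ is bounded. A disk centered at $\infty$ is a set of the form $\{z\in\mathbb{C}:|z|>R\}\cup\{\infty\}$ with $R>0$. Saying that an entire function ''has Baker omitted value'' means that $\infty$ is a Baker omitted value of it. *)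

(* Defs.v *)
From HB Require Import structures.
From mathcomp Require Import all_boot all_order all_algebra.
From mathcomp Require Import all_classical all_reals all_analysis.
From mathcomp Require Import complex.

Set Implicit Arguments.
Unset Strict Implicit.
Unset Printing Implicit Defensive.

Import Order.TTheory GRing.Theory Num.Theory.
Import numFieldNormedType.Exports.

Local Open Scope classical_set_scope.
Local Open Scope ring_scope.
Local Open Scope complex_scope.

(* The complex numbers, typed as a numClosedFieldType so that they inherit the
   generic normed topology given by the modulus (R[i] alone has no topology).
   [`|z|] is an element of [Cplx R] with zero imaginary part, whence the casts
   [r%:C] in comparisons with a real radius r. *)
Definition Cplx (R : realType) : numClosedFieldType := R[i].

Definition cexp (R : realType) (z : Cplx R) : Cplx R :=
  (expR (complex.Re z))%:C * (cos (complex.Im z) +i* sin (complex.Im z)).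

(* The increments range over the complex numbers: this is complex
   differentiability at every point. *)
Definition entire (R : realType) (f : Cplx R -> Cplx R) : Prop :=
  forall z : Cplx R, derivable f z 1.

(* [Some z] is the finite point z and [None] is the point at infinity. *)
Notation sphere R := (one_point_compactification (Cplx R)).

Definition sphere_disk (R : realType) (a : sphere R) (r : R) : set (sphere R) :=
  match a with
  | Some c => [set Some z | z in [set z : Cplx R | `|z - c| < r%:C]]
  | None => [set Some z | z in [set z : Cplx R | r%:C < `|z|]] `|` [set None]
  end.

Definition omitted_value (R : realType) (f : Cplx R -> Cplx R) (a : sphere R) :
    Prop :=
  forall z : Cplx R, Some (f z) <> a.

Definition boundary (T : topologicalType) (A : set T) : set T :=
  closure A `\` interior A.

Definition baker_omitted_value (R : realType) (f : Cplx R -> Cplx R)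
    (a : sphere R) : Prop :=
  [/\ entire f, omitted_value f a &
    exists r : R, 0 < r /\
      let B := boundary [set z : Cplx R | sphere_disk a r (Some (f z))] in
      forall z : Cplx R, B z -> bounded_set (connected_component B z)].

(* Main.v *)
Require Import Defs.
From HB Require Import structures.
From mathcomp Require Import all_boot all_order all_algebra.
From mathcomp Require Import all_classical all_reals all_analysis.
From mathcomp Require Import complex.
From mathcomp Require Import ring lra.

Import Order.TTheory GRing.Theory Num.Theory.
Import numFieldNormedType.Exports.

Local Open Scope classical_set_scope.
Local Open Scope ring_scope.
Local Open Scope complex_scope.

(** Let [f z = cexp z + P.[z]] with [P] of degree [N >= 1] and leading
    coefficient [a], and use the disk of radius 1 about infinity. A boundary point
    of its preimage satisfies [|f z| <= 1], so it is enough to bound the connected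
    subsets of the set [|f| <= 1].

    On that set the two terms nearly cancel. The curves along which they can do so
    go to infinity close to the positive and negative imaginary directions, and
    they are cut into bounded pieces by horizontal lines. Indeed, on the line
    [Im z = y] the number [cexp z] has the constant direction [cos y +i* sin y],
    while for [|Re z|] small compared with [|y|] the number [P.[z]] has nearly the
    direction of [a * (i * y) ^+ N]. For the values of [y] such that these
    directions agree, which recur modulo [2 * pi] both upwards and downwards, there
    is no cancellation and [|f| > 1] near the imaginary axis. Farther to the right
    the exponential dominates, farther to the left the polynomial does, so that
    [|f| > 1] on the whole line ([modulus_gt1_horizontal_line]).

    The imaginary parts of the points of a component form an interval that avoids
    such ordinates above and below one of its points, so the component lies in a
    horizontal strip. In a strip the set [|f| <= 1] is bounded, by dominance of the
    exponential on the right and of the polynomial on the left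
    ([modulus_le1_strip_bounded]).

    That [f] is entire reduces to the derivative of [cexp] at 0, obtained from the
    first-order expansions of the real exponential, sine and cosine. *)

Set Implicit Arguments.
Unset Strict Implicit.

(** * Arithmetic of the modulus *)

(** The norm on [Cplx R] takes its values in [Cplx R]; its real part is the same
    number seen in the ordered field [R], where [lra] and [nra] apply. *)
Definition modulus (R : realType) (z : Cplx R) : R := complex.Re `|z|.

Lemma normE (R : realType) (z : Cplx R) : `|z| = (modulus z)%:C.
Proof. by case: z. Qed.

Lemma modulus_ge0 (R : realType) (z : Cplx R) : 0 <= modulus z.
Proof. by rewrite -lecR -normE; exact: normr_ge0. Qed.

Lemma modulusM (R : realType) (z w : Cplx R) :
  modulus (z * w) = modulus z * modulus w.
Proof. by apply: (@complexI R); rewrite rmorphM /= -!normE normrM. Qed.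

Lemma modulusN (R : realType) (z : Cplx R) : modulus (- z) = modulus z.
Proof. by rewrite /modulus normrN. Qed.

Lemma modulusX (R : realType) (z : Cplx R) n :
  modulus (z ^+ n) = modulus z ^+ n.
Proof. by apply: (@complexI R); rewrite rmorphXn /= -!normE normrX. Qed.

Lemma modulus_real (R : realType) (x : R) : modulus (x%:C : Cplx R) = `|x|.
Proof. by rewrite /modulus /= expr0n /= addr0 sqrtr_sqr. Qed.

Lemma ler_modulusD (R : realType) (z w : Cplx R) :
  modulus (z + w) <= modulus z + modulus w.
Proof. by rewrite -lecR rmorphD /= -!normE; exact: ler_normD. Qed.

Lemma ler_modulusBD (R : realType) (z w : Cplx R) :
  modulus z - modulus w <= modulus (z + w).
Proof.
rewrite lerBlDr -lecR rmorphD /= -!normE.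
by have := ler_normB (z + w) w; rewrite addrK.
Qed.

Lemma modulus_eq0 (R : realType) (z : Cplx R) : (modulus z == 0) = (z == 0).
Proof.
by rewrite -(normr_eq0 z) normE -(inj_eq (@complexI R)).
Qed.

Lemma modulus0 (R : realType) : modulus (0 : Cplx R) = 0.
Proof. by apply/eqP; rewrite modulus_eq0. Qed.

Lemma ler_Re_modulus (R : realType) (z : Cplx R) :
  `|complex.Re z| <= modulus z.
Proof. by rewrite -lecR -normE; exact: (@normc_ge_Re R). Qed.

Lemma ler_Im_modulus (R : realType) (z : Cplx R) :
  `|complex.Im z| <= modulus z.
Proof.
case: z => a b; rewrite /modulus /= -sqrtr_sqr ler_wsqrtr //.
by rewrite lerDr sqr_ge0.
Qed.

Lemma modulus_ler_ReIm (R : realType) (z : Cplx R) :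
  modulus z <= `|complex.Re z| + `|complex.Im z|.
Proof.
case: z => a b; rewrite /modulus /=.
rewrite -[leRHS]ger0_norm ?addr_ge0 // -sqrtr_sqr ler_wsqrtr //.
rewrite sqrrD !real_normK ?num_real // addrAC lerDl mulrn_wge0 //.
Qed.

Lemma continuous_Im (R : realType) :
  continuous (fun z : Cplx R => complex.Im z : R).
Proof.
move=> z; apply/(@cvgrPdist_lt _ _ _ _ (nbhs_filter z)) => e e0.
apply/nbhs_normP; exists e%:C; first by rewrite /= ltcR.
move=> w /=; rewrite normE ltcR; apply: le_lt_trans.
by apply: le_trans (ler_Im_modulus (z - w)); case: z w => [? ?] [? ?].
Qed.

(** * The complex exponential and differentiability *)

Lemma cexpD (R : realType) (z w : Cplx R) : cexp (z + w) = cexp z * cexp w.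
Proof.
case: z w => [a b] [c d]; rewrite /cexp /= expRD cosD sinD.
by apply/eqP; rewrite eq_complex /= !mul0r !subr0 !addr0; apply/andP; split;
  apply/eqP; ring.
Qed.

Lemma modulus_cexp (R : realType) (z : Cplx R) :
  modulus (cexp z) = expR (complex.Re z).
Proof.
rewrite /cexp modulusM modulus_real ger0_norm ?expR_ge0 //.
by rewrite /modulus /= cos2Dsin2 sqrtr1 mulr1.
Qed.

(** The limit of difference quotients excludes the increment 0 and divides by it;
    this multiplicative form combines better with several variables. *)
Lemma is_derive0_first_order (R : realType) (f : R -> R) (l e : R) :
  is_derive (0 : R) (1 : R) f l -> 0 < e ->
  exists d : R, 0 < d /\ forall t, `|t| < d -> `|f t - f 0 - t * l| <= e * `|t|.
Proof.
move=> [df dl] e0.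
move: df => /cvg_ex[l' Hl].
have ll : l' = l by rewrite -dl; apply/esym/cvg_lim.
move: Hl; rewrite ll => /cvgrPdist_le/(_ _ e0).
rewrite near_withinE => /nbhs_normP[d /= d0 Hd].
exists d; split=> // t td; have [->|t0] := eqVneq t 0.
  by rewrite subrr mul0r subrr normr0 mulr0.
have := Hd t; rewrite /= sub0r normrN => /(_ td t0).
rewrite addr0 /GRing.scale /= mulr1 => h.
have -> : f t - f 0 - t * l = - (t * (l - t^-1 * (f t - f 0))).
  by field.
by rewrite normrN normrM mulrC ler_wpM2r.
Qed.

(** With [h = s +i* t], [A = expR s - 1 - s], [B = cos t - 1] and
    [D = sin t - t], the real and imaginary parts of [cexp h - 1 - h] are
    [A * cos t + (1 + s) * B] and [A * sin t + (1 + s) * D + s * t]. The first-order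
    expansions of the three real functions make each of the five terms small
    compared with [modulus h]. *)
Lemma cexp_first_order (R : realType) (e : R) : 0 < e ->
  exists d : R, 0 < d /\ forall h : Cplx R, modulus h < d ->
    modulus (cexp h - 1 - h) <= e * modulus h.
Proof.
move=> e0; have [e' [e'0 e'1 e'e]] : exists e', [/\ 0 < e', e' <= 1 & e' <= e / 8].
  exists (Num.min 1 (e / 8)); rewrite ge_min lexx ge_min lexx orbT; split=> //.
  by rewrite lt_min; apply/andP; split; lra.
have [d1 [d10 H1]] := is_derive0_first_order (is_derive_expR 0) e'0.
have [d2 [d20 H2]] := is_derive0_first_order (is_derive_cos 0) e'0.
have [d3 [d30 H3]] := is_derive0_first_order (is_derive_sin 0) e'0.
exists (Num.min (Num.min d1 d2) (Num.min d3 e')).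
split; first by rewrite !lt_min d10 d20 d30 e'0.
case=> s t hd.
have /andP[sh th] : (`|s| <= modulus (s +i* t : Cplx R)) &&
    (`|t| <= modulus (s +i* t : Cplx R)).
  by rewrite (ler_Re_modulus (s +i* t)) (ler_Im_modulus (s +i* t)).
set m := modulus _ in hd sh th *.
move: hd; rewrite !lt_min => /andP[/andP[m1 m2] /andP[m3 m4]].
have := H1 s (le_lt_trans sh m1); have := H2 t (le_lt_trans th m2).
have := H3 t (le_lt_trans th m3).
rewrite expR0 sin0 cos0 !(oppr0, mulr0, addr0, mulr1).
set A := expR s - 1 - s; set B := cos t - 1; set D := sin t - t => hD hB hA.
apply: le_trans (modulus_ler_ReIm _) _.
have -> : complex.Re (cexp (s +i* t : Cplx R) - 1 - (s +i* t))
    = A * cos t + (1 + s) * B by rewrite /cexp /= /A /B; ring.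
have -> : complex.Im (cexp (s +i* t : Cplx R) - 1 - (s +i* t))
    = A * sin t + (1 + s) * D + s * t by rewrite /cexp /= /A /D; ring.
have hs : `|1 + s| <= 2.
  by apply: (le_trans (ler_normD _ _)); rewrite normr1; lra.
have h1 : `|A * cos t| <= e' * m.
  rewrite normrM -[leRHS]mulr1 ler_pM ?cos_max //.
  by apply: le_trans hA _; rewrite ler_wpM2l // ltW.
have h2 : `|A * sin t| <= e' * m.
  rewrite normrM -[leRHS]mulr1 ler_pM ?sin_max //.
  by apply: le_trans hA _; rewrite ler_wpM2l // ltW.
have h3 : `|(1 + s) * B| <= 2 * (e' * m).
  rewrite normrM ler_pM //.
  by apply: le_trans hB _; rewrite ler_wpM2l // ltW.
have h4 : `|(1 + s) * D| <= 2 * (e' * m).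
  rewrite normrM ler_pM //.
  by apply: le_trans hD _; rewrite ler_wpM2l // ltW.
have h5 : `|s * t| <= e' * m.
  by rewrite normrM ler_pM // ltW // (le_lt_trans sh).
have h6 : e' * m <= e / 8 * m by rewrite ler_wpM2r // /m modulus_ge0.
have h7 : 0 <= e * m by rewrite mulr_ge0 ?modulus_ge0 // ltW.
have := ler_normD (A * cos t) ((1 + s) * B).
have := ler_normD (A * sin t + (1 + s) * D) (s * t).
have := ler_normD (A * sin t) ((1 + s) * D).
lra.
Qed.

(** By the addition formula it suffices to differentiate at 0. *)
Lemma derivable_cexp (R : realType) (z : Cplx R) : derivable (@cexp R) z 1.
Proof.
apply/cvg_ex; exists (cexp z); apply/cvgrPdist_le => e e0.
have eE : e = (modulus e)%:C by rewrite -normE gtr0_norm.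
have eR : 0 < modulus e / (modulus (cexp z) + 1).
  rewrite divr_gt0 //; first by move: e0; rewrite {1}eE ltcR.
  by rewrite ltr_wpDl // modulus_ge0.
have [d [d0 Hd]] := cexp_first_order eR.
rewrite near_withinE; apply/nbhs_normP; exists d%:C; first by rewrite /= ltcR.
move=> h /=; rewrite sub0r normrN normE ltcR => hd h0.
have {}Hd := Hd h hd.
have hm : 0 < modulus h by rewrite lt0r modulus_ge0 modulus_eq0 h0.
rewrite eE normE lecR.
rewrite -(ler_pM2l hm) -modulusM.
have -> : h * (cexp z - h^-1 *: (cexp (h%:A + z) - cexp z))
    = (- cexp z) * (cexp h - 1 - h).
  by rewrite cexpD /GRing.scale /= mulr1; field.
rewrite !modulusM modulusN.
have E0 := modulus_ge0 (cexp z).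
apply: le_trans (ler_wpM2l E0 Hd) _.
rewrite -[X in _ <= _ * X](divfK (x := modulus (cexp z) + 1)) ?gt_eqF ?ltr_wpDl //.
set q := modulus e / _ in eR *.
have := mulr_ge0 (ltW eR) (ltW hm); lra.
Qed.

(** Stated over an abstract [numFieldType], where the rule for products elaborates
    quickly; it specializes to [Cplx R] by conversion. *)
Lemma derivable_hornerE (K : numFieldType) (P : {poly K}) (z : K) :
  derivable (fun w : K => P.[w]) z 1.
Proof.
elim/poly_ind: P => [|p c IH].
  have -> : (fun w : K => (0 : {poly K}).[w]) = cst 0.
    by apply/funext => w; rewrite horner0.
  exact: derivable_cst.
have -> : (fun w : K => (p * 'X + c%:P).[w]) =
    (fun w => p.[w]) * id + cst c.
  by apply/funext => w; rewrite hornerD hornerMX hornerC.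
apply: derivableD; last exact: derivable_cst.
by apply: derivableM => //; exact: derivable_id.
Qed.

Lemma entire_cexp_add_horner (R : realType) (P : {poly Cplx R}) :
  entire (fun z : Cplx R => cexp z + P.[z]).
Proof.
move=> z; apply: (@derivableD _ _ _ (@cexp R) (fun w : Cplx R => P.[w])).
  exact: derivable_cexp.
exact: (@derivable_hornerE (Cplx R) P z).
Qed.

Lemma derivable_modulus_continuous (R : realType) (f : Cplx R -> Cplx R)
    (z : Cplx R) :
  derivable f z 1 -> forall e : R, 0 < e ->
  exists d : R, 0 < d /\ forall w, modulus (w - z) < d ->
    modulus (f w - f z) < e.
Proof.
move=> df e e0.
have /differentiable_continuous cf : differentiable f z by exact/derivable1_diffP.
have eC : 0 < e%:C :> Cplx R by rewrite ltcR.
have /cvgrPdist_lt/(_ _ eC)/nbhs_normP[d /= d0 Hd] := cf.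
have dE : d = (modulus d)%:C by rewrite -normE gtr0_norm.
exists (modulus d); split; first by move: d0; rewrite {1}dE ltcR.
move=> w wz; rewrite -ltcR -normE distrC; apply: Hd.
by rewrite /= distrC normE dE ltcR.
Qed.

(** * Growth of polynomials and of the exponential *)

(** The term of degree [n.+1] of the exponential series alone exceeds [C * x ^+ n]
    as soon as [x] exceeds [C * (n.+1)`!]. *)
Lemma monomial_le_expR (R : realType) (C : R) (n : nat) :
  exists X : R, 1 <= X /\ forall x, X <= x -> C * x ^+ n + 1 <= expR x.
Proof.
have D0 : 0 < (n.+1)`!%:R :> R by rewrite ltr0n fact_gt0.
exists (Num.max 1 (C * (n.+1)`!%:R)); split; first by rewrite le_max lexx.
move=> x; rewrite ge_max => /andP[x1 xC].
have x0 : 0 <= x by apply: le_trans x1.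
have xn : 0 < x ^+ n by apply: exprn_gt0; apply: lt_le_trans x1.
apply: le_trans (expR_ge1Dxn n x0); rewrite addrC lerD2l.
by rewrite ler_pdivlMr // exprSr mulrAC [x ^+ n * x]mulrC ler_pM2r.
Qed.

Lemma horner_le_monomial (R : realType) (Q : {poly Cplx R}) (n : nat) :
  (size Q <= n.+1)%N ->
  exists C : R, 0 <= C /\
    forall z, 1 <= modulus z -> modulus Q.[z] <= C * modulus z ^+ n.
Proof.
move=> sQ; exists (\sum_(i < size Q) modulus Q`_i); split.
  by apply: sumr_ge0 => i _; exact: modulus_ge0.
move=> z z1; rewrite horner_coef mulr_suml.
apply: le_trans (_ : \sum_(i < size Q) modulus (Q`_i * z ^+ i) <= _).
  elim/big_rec2: _ => [|i x y _ xy]; first by rewrite modulus0.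
  by apply: le_trans (ler_modulusD _ _) _; rewrite lerD2l.
apply: ler_sum => i _; rewrite modulusM modulusX ler_wpM2l ?modulus_ge0 //.
by apply: ler_weXn2l => //; rewrite -ltnS (leq_trans (ltn_ord i)).
Qed.

(** Beyond the unit disk a polynomial is its leading monomial up to an error one
    degree lower; every asymptotic estimate on [P] below comes from this. *)
Lemma horner_sub_lead (R : realType) (P : {poly Cplx R}) (n : nat) :
  size P = n.+2 ->
  exists C : R, 0 <= C /\ forall z, 1 <= modulus z ->
    modulus (P.[z] - lead_coef P * z ^+ n.+1) <= C * modulus z ^+ n.
Proof.
move=> sP; pose Q := P - lead_coef P *: 'X^(n.+1).
have sQ : (size Q <= n.+1)%N.
  apply/leq_sizeP => j; rewrite leq_eqVlt => /orP[/eqP <-|nj].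
    by rewrite coefB coefZ coefXn eqxx mulr1 lead_coefE sP subrr.
  rewrite coefB coefZ coefXn gtn_eqF // mulr0 subr0.
  by apply: nth_default; rewrite sP.
have [C [C0 HC]] := horner_le_monomial sQ.
exists C; split=> // z z1.
by have := HC z z1; rewrite /Q hornerD hornerN hornerZ hornerXn.
Qed.

Lemma modulus_lead_coef_gt0 (R : realType) (P : {poly Cplx R}) (n : nat) :
  size P = n.+1 -> 0 < modulus (lead_coef P).
Proof.
by move=> sP; rewrite lt0r modulus_ge0 modulus_eq0 lead_coef_eq0 -size_poly_eq0 sP.
Qed.

(** * Regions where the modulus of the sum exceeds one *)

(** There the exponential has modulus at most 1 while the polynomial is large. *)
Lemma modulus_gt1_left_half_plane (R : realType) (P : {poly Cplx R}) (n : nat) :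
  size P = n.+2 -> exists r : R, forall z : Cplx R,
  complex.Re z <= 0 -> r <= modulus z -> 1 < modulus (cexp z + P.[z]).
Proof.
move=> sP; set a := lead_coef P.
have a_gt0 : 0 < modulus a := modulus_lead_coef_gt0 sP.
have [C [C0 HC]] := horner_sub_lead sP.
(* Past this radius [modulus P.[z] >= 3], against at most 1 for [cexp z]. *)
exists (Num.max 1 ((C + 3) / modulus a)) => z z0.
rewrite ge_max ler_pdivrMr // => /andP[z1 zC].
have {}HC := HC z z1; rewrite addrC.
apply: lt_le_trans (ler_modulusBD _ _).
rewrite modulus_cexp.
have e1 : expR (complex.Re z) <= 1 by rewrite expR_le1.
have h := ler_modulusBD (a * z ^+ n.+1) (P.[z] - a * z ^+ n.+1).
rewrite [X in _ <= modulus X]addrC subrK modulusM modulusX in h.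
have zn : 1 <= modulus z ^+ n by apply: exprn_ege1.
rewrite exprS in h.
nra.
Qed.

(** In a sector [|Im z| <= K * Re z] the modulus of [z] is comparable to its real
    part, so the exponential beats the polynomial. *)
Lemma modulus_gt1_right_sector (R : realType) (P : {poly Cplx R}) (K : R) : 0 <= K ->
  exists X : R, forall z : Cplx R, X <= complex.Re z ->
    `|complex.Im z| <= K * complex.Re z -> 1 < modulus (cexp z + P.[z]).
Proof.
move=> K0.
have [C [C0 HC]] := horner_le_monomial (leqnSn (size P)).
set n := size P in HC.
have [X [X1 HX]] := monomial_le_expR (C * (1 + K) ^+ n + 1) n.
exists X => z zX zK.
set x := complex.Re z in zX zK *.
have x1 : 1 <= x by apply: le_trans zX.
have x0 : 0 <= x by lra.
have xz : x <= modulus z by rewrite (le_trans _ (ler_Re_modulus z)) ?ler_norm.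
have zx : modulus z <= (1 + K) * x.
  apply: (le_trans (modulus_ler_ReIm z)).
  by rewrite (ger0_norm x0) mulrDl mul1r lerD2l.
have z1 : 1 <= modulus z by lra.
apply: lt_le_trans (ler_modulusBD _ _); rewrite modulus_cexp -/x.
have h1 := HC z z1.
have h2 : modulus z ^+ n <= (1 + K) ^+ n * x ^+ n.
  by rewrite -exprMn lerXn2r ?nnegrE ?modulus_ge0 // mulr_ge0 // addr_ge0.
have h3 : C * modulus z ^+ n <= C * ((1 + K) ^+ n * x ^+ n) by exact: ler_wpM2l.
have := HX x zX; rewrite mulrDl mul1r -mulrA => h4.
have xn : 1 <= x ^+ n by apply: exprn_ege1.
lra.
Qed.

(** Near the point [t * w], with [t] large, [P] is close to
    [t ^+ n.+1 * (lead_coef P * w ^+ n.+1)]. If [cexp z] is a nonnegative multiple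
    of the same number, the two terms add up instead of cancelling, so that the sum
    is at least about as large as [P] itself. *)
Lemma modulus_gt1_aligned (R : realType) (P : {poly Cplx R}) (n : nat) (w : Cplx R) :
  size P = n.+2 -> modulus w = 1 ->
  exists e T : R, 0 < e /\ forall (t : R) (z : Cplx R) (s : R),
    T <= t -> modulus (z - t%:C * w) <= e * t -> 0 <= s ->
    cexp z = s%:C * (lead_coef P * w ^+ n.+1) ->
    1 < modulus (cexp z + P.[z]).
Proof.
move=> sP w1; set a := lead_coef P.
have a_gt0 : 0 < modulus a := modulus_lead_coef_gt0 sP.
have [C [C0 HC]] := horner_sub_lead sP.
have q0 : (0 : R) < 4^-1 by rewrite invr_gt0.
have [d [d0 Hd]] := derivable_modulus_continuous
  (@derivable_hornerE (Cplx R) 'X^(n.+1) w) q0.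
(* With [e <= 1 / 2] the quotient [v = z / t] has modulus between 1 / 2 and 2. *)
pose e := Num.min (d / 2) (1 / 2).
have ed : e < d by rewrite gt_min; apply/orP; left; lra.
have e2 : e <= 1 / 2 by rewrite ge_min lexx orbT.
have e0 : 0 < e by rewrite lt_min; apply/andP; split; lra.
(* From this [T] on, a quarter of [t ^+ n.+1 * modulus a] absorbs the lower-order
   part of [P], bounded by [C * (2 * t) ^+ n], with [4 * t ^+ n] to spare; another
   quarter absorbs the variation of the monomial between [w] and [v]. *)
exists e, (Num.max 2 ((C * 2 ^+ n + 4) * 4 / modulus a)); split=> // t z s.
rewrite ge_max ler_pdivrMr // => /andP[t2 tC] zt s0 ez.
have t0 : 0 < t by lra.
have tC0 : t%:C != 0 :> Cplx R by rewrite (inj_eq (@complexI R)) gt_eqF.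
pose v := z / t%:C.
have zE : z = t%:C * v by rewrite /v mulrC mulfVK.
have vw : modulus (v - w) <= e.
  by move: zt; rewrite zE -mulrBr modulusM modulus_real gtr0_norm // mulrC ler_pM2r.
have v1 : 1 / 2 <= modulus v /\ modulus v <= 2.
  have h1 := ler_modulusD (v - w) w; have h2 := ler_modulusBD w (v - w).
  by rewrite [w + _]addrC in h2; rewrite subrK w1 in h1 h2; split; lra.
have zt2 : modulus z <= 2 * t /\ 1 <= modulus z.
  by rewrite zE modulusM modulus_real gtr0_norm //; split; nra.
have {}HC := HC z zt2.2; rewrite -/a in HC.
have {Hd vw} vw : modulus (v ^+ n.+1 - w ^+ n.+1) < 4^-1.
  by have := Hd v (le_lt_trans vw ed); rewrite !hornerXn.
(* The aligned main term, then the error from [v <> w], then the lower-order part. *)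
have -> : cexp z + P.[z] = (s + t ^+ n.+1)%:C * (a * w ^+ n.+1)
    + (t ^+ n.+1)%:C * a * (v ^+ n.+1 - w ^+ n.+1)
    + (P.[z] - a * z ^+ n.+1).
  have zN : z ^+ n.+1 = (t ^+ n.+1)%:C * v ^+ n.+1.
    by rewrite [in LHS]zE exprMn rmorphXn.
  by rewrite ez zN rmorphD /=; ring.
apply: lt_le_trans (ler_modulusBD _ _).
have := ler_modulusBD ((s + t ^+ n.+1)%:C * (a * w ^+ n.+1))
  ((t ^+ n.+1)%:C * a * (v ^+ n.+1 - w ^+ n.+1)).
have tn0 : 0 < t ^+ n by apply: exprn_gt0.
have tn1 : 1 <= t ^+ n by apply: exprn_ege1; lra.
have tN0 : 0 < t ^+ n.+1 by apply: exprn_gt0.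
rewrite !modulusM !modulusX w1 expr1n !modulus_real mulr1.
rewrite (ger0_norm (addr_ge0 s0 (ltW tN0))) (gtr0_norm tN0) => h1.
have h2 : C * modulus z ^+ n <= C * (2 ^+ n * t ^+ n).
  rewrite ler_wpM2l // -exprMn lerXn2r ?nnegrE ?modulus_ge0 //; last exact: zt2.1.
  lra.
set A := modulus a in a_gt0 tC h1 *.
have h3 : t ^+ n.+1 * A * modulus (v ^+ n.+1 - w ^+ n.+1) <= t ^+ n.+1 * A * 4^-1.
  by rewrite ler_wpM2l ?ltW // mulr_gt0.
have h4 : (C * 2 ^+ n + 4) * t ^+ n <= t ^+ n.+1 * A / 4.
  by have := ler_wpM2r (ltW tn0) tC; rewrite exprSr; lra.
have h5 : 0 <= s * A by rewrite mulr_ge0 // ltW.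
rewrite mulrDl -mulrA in h4.
rewrite mulrDl in h1.
have h6 : 0 < t ^+ n.+1 * A by exact: mulr_gt0.
lra.
Qed.

(** In a horizontal strip, large points lie either in the left half-plane or in
    the sector [|Im z| <= Re z]. *)
Lemma modulus_le1_strip_bounded (R : realType) (P : {poly Cplx R}) (n : nat)
    (Y : R) :
  size P = n.+2 ->
  exists B : R, forall z : Cplx R, `|complex.Im z| <= Y ->
    modulus (cexp z + P.[z]) <= 1 -> modulus z <= B.
Proof.
move=> sP.
have [X HX] := modulus_gt1_right_sector P ler01.
have [r Hr] := modulus_gt1_left_half_plane sP.
exists (Num.max r (Num.max X Y + Y)) => z zY fz; rewrite le_max.
case: (lerP (complex.Re z) 0) => x0.
  case: (lerP r (modulus z)) => [rz|/ltW -> //].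
  by have := Hr z x0 rz; rewrite ltNge fz.
apply/orP; right; apply: le_trans (modulus_ler_ReIm z) _.
rewrite lerD // (gtr0_norm x0) leNgt; apply/negP => /ltW.
rewrite ge_max => /andP[zX Yz].
by have := HX z zX; rewrite mul1r (le_trans zY Yz) ltNge fz => /(_ isT).
Qed.

(** * Horizontal lines that avoid the level set *)

Lemma unit_circle_angle (R : realType) (u : Cplx R) : modulus u = 1 ->
  exists y : R, u = cos y +i* sin y.
Proof.
case: u => c s; rewrite /modulus /= => h.
have {h} cs : c ^+ 2 + s ^+ 2 = 1.
  by rewrite -[LHS]sqr_sqrtr ?h ?expr1n // addr_ge0 ?sqr_ge0.
have c1 : -1 <= c <= 1 by apply/andP; split; nra.
have ca : cos (acos c) = c by have [] := acos_def c1.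
have sa : sin (acos c) = `|s|.
  by rewrite sin_acos // -cs addrAC subrr add0r sqrtr_sqr.
case: (ger0P s) sa => s0 sa; [exists (acos c)|exists (- acos c)].
  by rewrite ca sa.
by rewrite cosN sinN ca sa opprK.
Qed.

(** Arguments of [u] are determined modulo [2 * pi] only, so that they can be
    taken beyond any bound. *)
Lemma unit_circle_angle_ge (R : realType) (u : Cplx R) (T : R) :
  modulus u = 1 -> exists y : R, T <= y /\ u = cos y +i* sin y.
Proof.
move=> u1; have [y uE] := unit_circle_angle u1.
have p2 := pi_ge2 R; pose k := Num.bound `|T - y|.
exists (y + pi *+ 2 *+ k); split; last first.
  by rewrite (periodicn (@cosD2pi R)) (periodicn (@sinD2pi R)).
have kT : `|T - y| < k%:R by rewrite archi_boundP.
have Ty := ler_norm (T - y).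
suff : k%:R <= pi *+ 2 *+ k :> R by lra.
by rewrite ler_wMn2r // mulr2n; lra.
Qed.

Lemma unit_circle_angle_le (R : realType) (u : Cplx R) (T : R) :
  modulus u = 1 -> exists y : R, y <= T /\ u = cos y +i* sin y.
Proof.
move=> u1; have [|y [Ty]] := @unit_circle_angle_ge R (u^*)%C (- T).
  by rewrite /modulus normcJ.
case: u u1 => c s _ [-> sE]; exists (- y); split; first by rewrite lerNl.
by rewrite cosN sinN -sE opprK.
Qed.

(** Both signs of [sg] are treated at once: take [w = sg * 'i] and choose the
    ordinate [y] among the arguments of the unit vector along
    [lead_coef P * w ^+ n.+1], so that [cexp] has this direction on the whole
    line. The part of the line near the imaginary axis is then covered by the
    aligned estimate, the part to its right by the sector estimate and the part to
    its left by the half-plane estimate. *)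
Lemma modulus_gt1_horizontal_line (R : realType) (P : {poly Cplx R})
    (n : nat) (sg M : R) :
  size P = n.+2 -> `|sg| = 1 ->
  exists y : R, M <= sg * y /\
    forall z : Cplx R, complex.Im z = y -> 1 < modulus (cexp z + P.[z]).
Proof.
move=> sP sg1; pose w : Cplx R := 0 +i* sg.
have w1 : modulus w = 1 by rewrite /modulus /= expr0n add0r sqrtr_sqr.
set a := lead_coef P.
have a_gt0 : 0 < modulus a := modulus_lead_coef_gt0 sP.
have [e [T [e0 HT]]] := modulus_gt1_aligned sP w1.
have [X HX] := modulus_gt1_right_sector P (ltW (divr_gt0 ltr01 e0)).
have [r Hr] := modulus_gt1_left_half_plane sP.
pose u := ((modulus a)^-1)%:C * (a * w ^+ n.+1).
have u1 : modulus u = 1.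
  rewrite /u !modulusM modulusX w1 expr1n mulr1 modulus_real.
  by rewrite gtr0_norm ?invr_gt0 // mulVf // gt_eqF.
pose Y := Num.max (Num.max M T) (Num.max (X / e) (Num.max 0 r)).
have [y [yY uE]] : exists y, Y <= sg * y /\ u = cos y +i* sin y.
  have [->|->] : sg = 1 \/ sg = -1.
    by case: (ger0P sg) sg1 => _ h; [left|right]; lra.
    by have [y ?] := unit_circle_angle_ge Y u1; exists y; rewrite mul1r.
  have [y [? ?]] := unit_circle_angle_le (- Y) u1; exists y.
  by rewrite mulN1r lerNr.
move: yY; rewrite !ge_max => /andP[/andP[yM yT] /and3P[yX y0 yr]].
exists y; split=> // z zy.
have sy : sg * (sg * y) = y.
  by rewrite mulrA -expr2 -real_normK ?num_real // sg1 expr1n mul1r.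
have yn : `|y| = sg * y by rewrite -(ger0_norm y0) normrM sg1 mul1r.
case: (lerP `|complex.Re z| (e * (sg * y))) => xe.
- apply: (HT (sg * y) z (expR (complex.Re z) / modulus a)) => //.
  + have -> : z - (sg * y)%:C * w = (complex.Re z)%:C.
      case: z zy {xe} => x y' /= ->; apply/eqP; rewrite eq_complex /=.
      by rewrite !mul0r !mulr0 addr0 !subr0 mulrC sy subrr !eqxx.
    by rewrite modulus_real.
  + by rewrite divr_ge0 ?expR_ge0 // ltW.
  + by rewrite rmorphM /= -mulrA -/a -/u uE /cexp zy.
- case: (lerP (complex.Re z) 0) => x0.
    apply: Hr => //; apply: le_trans yr _; rewrite -yn -zy.
    exact: ler_Im_modulus.
  rewrite (gtr0_norm x0) in xe.
  apply: HX.
    by apply: le_trans (ltW xe); rewrite mulrC -ler_pdivrMr.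
  by rewrite zy yn mul1r ler_pdivlMl // ltW.
Qed.

(** * Components of the boundary *)

(** The set where the modulus exceeds [r] is open, so that none of its points is on
    its boundary. *)
Lemma modulus_le_boundary (R : realType) (f : Cplx R -> Cplx R) (r : R)
    (z : Cplx R) :
  entire f ->
  boundary [set w : Cplx R | sphere_disk (None : sphere R) r (Some (f w))] z ->
  modulus (f z) <= r.
Proof.
move=> ef [_ nint]; rewrite leNgt; apply/negP => rz; apply: nint.
have e0 : 0 < modulus (f z) - r by rewrite subr_gt0.
have [d [d0 Hd]] := derivable_modulus_continuous (ef z) e0.
apply/nbhs_normP; exists d%:C; first by rewrite /= ltcR.
move=> w /=; rewrite distrC normE ltcR => /Hd wz.
left; exists (f w) => //=; rewrite normE ltcR.
have := ler_modulusBD (f z) (f w - f z); rewrite [f z + _]addrC subrK; lra.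
Qed.

Unset Implicit Arguments.

Theorem theorem1p1 (R : realType) (P : {poly Cplx R}) (hP : (1 < size P)%N) :
  baker_omitted_value (fun z : Cplx R => cexp z + P.[z]) None.
Proof.
have ef := @entire_cexp_add_horner R P.
split=> //; exists 1; split; first exact: ltr01.
move=> B z Bz; pose f (w : Cplx R) := cexp w + P.[w].
have [n sP] : exists n, size P = n.+2 by case: (size P) hP => [|[|n]] // _; exists n.
have fB w : B w -> modulus (f w) <= 1 by exact: (@modulus_le_boundary R f 1).
have [y1 [y1z H1]] := modulus_gt1_horizontal_line (complex.Im z) sP (normr1 R).
have [y2 [y2z H2]] := modulus_gt1_horizontal_line (- complex.Im z) sP (normrN1 R).
have avoid w : connected_component B z w ->
    complex.Im w != y1 /\ complex.Im w != y2.
  move=> /connected_component_sub/fB fw.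
  by split; apply/eqP => wy; [have := H1 w wy|have := H2 w wy]; rewrite ltNge fw.
pose J := [set complex.Im w | w in connected_component B z].
have /connected_intervalP iJ : connected J.
  apply: connected_continuous_connected; first exact: component_connected.
  exact/continuous_subspaceT/continuous_Im.
have Jz : J (complex.Im z) by exists z => //; exact: connected_component_refl.
have strip w : connected_component B z w -> y2 <= complex.Im w <= y1.
  move=> Cw; have Jw : J (complex.Im w) by exists w.
  apply/andP; split; rewrite leNgt; apply/negP => wy.
    have [v Cv vE] : J y2 by apply: (iJ _ _ Jw Jz); rewrite (ltW wy); lra.
    by have [_] := avoid v Cv; rewrite vE eqxx.
  have [v Cv vE] : J y1 by apply: (iJ _ _ Jz Jw); rewrite (ltW wy); lra.
  by have [] := avoid v Cv; rewrite vE eqxx.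
have [b Hb] := modulus_le1_strip_bounded (`|y1| + `|y2|) sP.
exists b%:C; split; first by apply/complex_realP; exists b.
move=> x bx w Cw /=; apply: le_trans (ltW bx); rewrite normE lecR.
apply: Hb; last by apply: fB; exact: connected_component_sub Cw.
have /andP[w2 w1] := strip w Cw.
have := ler_norm y1; have := ler_norm (- y2); rewrite normrN => h2 h1.
have := normr_ge0 y1; have := normr_ge0 y2 => g2 g1.
by rewrite ler_norml; apply/andP; split; lra.
Qed.
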